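(* Let $\lambda$ be a nonzero real number and let $F_{n,\lambda}$ ($n\ge 0$) be the degenerate Fubini numbers. Then for every integer $n\ge 1$, $$F_{n,\lambda}=2\sum_{l=0}^{n}\binom{n}{l}F_{l,\lambda}(-1)^{n-l}\langle 1\rangle_{n-l,\lambda}+(-1)^{n-1}\langle 1\rangle_{n,\lambda},$$ and $$\sum_{k=0}^{n}\binom{n}{k}(1-\lambda)_{n-k,\lambda}F_{k,\lambda}=2\sum_{k=0}^{n}\binom{n}{k}(-1)^{n-k}\langle \lambda\rangle_{n-k,\lambda}F_{k,\lambda}+(-1)^{n-1}\langle \lambda\rangle_{n,\lambda}.$$
   Context: For a nonzero real number $\lambda$: generalized falling factorials $(x)_{0,\lambda}=1$, $(x)_{n,\lambda}=x(x-\lambda)\cdots(x-(n-1)\lambda)$ for $n\ge 1$; generalized rising factorials $\langle x\rangle_{0,\lambda}=1$, $\langle x\rangle_{n,\lambda}=x(x+\lambda)\cdots(x+(n-1)\lambda)$ for $n\ge 1$. With $(x)_0=1$ and $(x)_n=x(x-1)\cdots(x-n+1)$ for $n\ge 1$, the degenerate Stirling numbers of the second kind ${n \brace k}_{\lambda}$ ($0\le k\le n$) are defined by the polynomial identity $(x)_{n,\lambda}=\sum_{k=0}^{n}{n \brace k}_{\lambda}(x)_{k}$, $n\ge 0$. The degenerate Fubini numbers are $F_{n,\lambda}=\sum_{k=0}^{n}{n \brace k}_{\lambda}k!$. *)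

(* Defs.v *)
From HB Require Import structures.
From mathcomp Require Import all_boot all_order all_algebra.
From mathcomp Require Import boolp reals ring.

Set Implicit Arguments.
Unset Strict Implicit.
Unset Printing Implicit Defensive.

Import Order.TTheory GRing.Theory Num.Theory.
Local Open Scope ring_scope.

(* Stated over a commutative ring so that the same products can be taken at
   a scalar and, with parameter lam%:P, at the indeterminate 'X. *)
Definition dfalling (A : comNzRingType) (lam x : A) (n : nat) : A :=
  \prod_(i < n) (x - lam *+ i).

Definition drising (A : comNzRingType) (lam x : A) (n : nat) : A :=
  \prod_(i < n) (x + lam *+ i).

Definition falling (A : comNzRingType) (x : A) (n : nat) : A :=
  \prod_(i < n) (x - i%:R).

(* S n k is the degenerate Stirling number of the second kind {n brace k}_lam
   for k <= n; the values of S n k with k > n are unconstrained and unused.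
   Lemmas is_dstirling2_exists and is_dstirling2_uniq show that this
   determines the numbers. *)
Definition is_dstirling2 (R : realType) (lam : R) (S : nat -> nat -> R) : Prop :=
  forall n : nat,
    dfalling lam%:P 'X n = \sum_(k < n.+1) S n k *: falling ('X : {poly R}) k.

Definition dfubini (R : realType) (S : nat -> nat -> R) (n : nat) : R :=
  \sum_(k < n.+1) S n k * k`!%:R.

Lemma size_falling (R : realType) (k : nat) :
  size (falling ('X : {poly R}) k) = k.+1.
Proof.
rewrite /falling; under eq_bigr => i _ do rewrite -polyC_natr.
by rewrite size_prod_XsubC /index_enum -enumT size_enum_ord.
Qed.

Lemma falling_free (R : realType) (n : nat) (c : nat -> R) :
  \sum_(k < n.+1) c k *: falling ('X : {poly R}) k = 0 ->
  forall k, (k <= n)%N -> c k = 0.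
Proof.
have lt_size m : (size (\sum_(k < m) c k *: falling ('X : {poly R}) k)%R <= m)%N.
  apply: (leq_trans (size_sum _ _ _)); apply/bigmax_leqP => i _.
  by apply: (leq_trans (size_scale_leq _ _)); rewrite size_falling.
elim: n => [|n IHn]; rewrite big_ord_recr /= => sum0.
  move=> k; rewrite leqn0 => /eqP ->; move: sum0.
  rewrite big_ord0 add0r => /eqP; rewrite scaler_eq0 -size_poly_eq0.
  by rewrite size_falling orbF => /eqP.
have cn0 : c n.+1 = 0.
  move/(congr1 (fun p : {poly R} => p`_n.+1)): sum0.
  rewrite coefD nth_default ?lt_size // add0r coefZ coef0.
  move/eqP; rewrite mulf_eq0 => /orP[/eqP //|].
  have := lead_coef_eq0 (falling ('X : {poly R}) n.+1).
  by rewrite lead_coefE size_falling /= -size_poly_eq0 size_falling => ->.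
move=> k; rewrite leq_eqVlt => /orP[/eqP -> //|]; rewrite ltnS; apply: IHn.
by move: sum0; rewrite cn0 scale0r addr0.
Qed.

Lemma is_dstirling2_uniq (R : realType) (lam : R) (S T : nat -> nat -> R) :
  is_dstirling2 lam S -> is_dstirling2 lam T ->
  forall n k, (k <= n)%N -> S n k = T n k.
Proof.
move=> hS hT n k lekn; apply/eqP; rewrite -subr_eq0; apply/eqP.
apply: (@falling_free R n (fun k => S n k - T n k)) => //.
under eq_bigr => i _ do rewrite scalerBl.
by rewrite sumrB -hS -hT subrr.
Qed.

Lemma is_dstirling2_exists (R : realType) (lam : R) :
  exists S, is_dstirling2 lam S.
Proof.
suff row n : exists c : nat -> R,
    dfalling lam%:P 'X n = \sum_(k < n.+1) c k *: falling ('X : {poly R}) k.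
  by have [S hS] := boolp.choice row; exists S.
elim: n => [|n [c IHn]].
  by exists (fun=> 1); rewrite big_ord1 scale1r /dfalling /falling !big_ord0.
exists (fun k => (if k is j.+1 then c j else 0) +
  (if (k <= n)%N then (k%:R - lam *+ n) * c k else 0)).
under [RHS]eq_bigr => k _ do rewrite scalerDl.
rewrite big_split /= big_ord_recl /= scale0r add0r.
rewrite [X in _ = _ + X]big_ord_recr /= ltnn scale0r addr0.
rewrite /dfalling big_ord_recr /= -/(dfalling _ _ _) IHn mulr_suml -big_split /=.
apply: eq_bigr => k _; rewrite -ltnS ltn_ord /bump leq0n add1n.
have -> : falling ('X : {poly R}) k.+1 = falling 'X k * ('X - k%:R).
  by rewrite /falling big_ord_recr.
rewrite add0n -!mul_polyC !polyCM polyCB polyC_natr polyCMn; ring.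
Qed.

(* Main.v *)
Require Import Defs.
From HB Require Import structures.
From mathcomp Require Import all_boot all_order all_algebra.
From mathcomp Require Import reals.
From mathcomp Require Import ring.

Import Order.TTheory GRing.Theory Num.Theory.
Local Open Scope ring_scope.

(** Let [L] be the linear functional on polynomials that sends the falling
    factorial [(X)_k] to [k!], so that [F_n = L ((X)_(n,lam))].  The rule
    [(X+1)_k = (X)_k + k (X)_(k-1)] gives

      [L (p (X+1)) = 2 L (p) - p (0)],

    while the degenerate Vandermonde identity ([dfallingD]) gives

      [L ((X+y)_(n,lam)) = \sum_k 'C(n,k) (y)_(n-k,lam) F_k].

    Applying the first rule to [p = (X+y)_(n,lam)] yields [dfubini_shift], an
    identity valid for every [y].  The two formulas are its instances [y = -1]
    and [y = - lam], since [(-x)_(m,lam) = (-1)^m <x>_(m,lam)].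

    The functional is realised by Newton's formula: on polynomials of degree at
    most [n], [L p] is the sum of the iterated forward differences of [p] at 0
    of orders 0 to [n], which is visibly linear. *)

Section Factorials.
Variable A : comNzRingType.
Implicit Types (lam x y : A) (n : nat).

Lemma dfallingS lam x n :
  dfalling lam x n.+1 = dfalling lam x n * (x - lam *+ n).
Proof. by rewrite /dfalling big_ord_recr. Qed.

Lemma dfalling0 x lam : dfalling lam x 0 = 1.
Proof. by rewrite /dfalling big_ord0. Qed.

Lemma dfallingN lam x n :
  dfalling lam (- x) n = (-1) ^+ n * drising lam x n.
Proof.
elim: n => [|n IHn]; first by rewrite dfalling0 /drising big_ord0 mulr1.
rewrite dfallingS IHn /drising big_ord_recr /= exprS; ring.
Qed.

Lemma dfallingD lam x y n :
  dfalling lam (x + y) n =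
  \sum_(k < n.+1) 'C(n, k)%:R * dfalling lam y (n - k)%N * dfalling lam x k.
Proof.
elim: n => [|n IHn]; first by rewrite big_ord1 !dfalling0 !mulr1.
(* The last factor splits as (x - k lam) + (y - (n-k) lam) in the k-th term;
   Pascal's rule then recombines the two resulting sums. *)
pose a k := 'C(n, k)%:R * dfalling lam y (n - k)%N * dfalling lam x k.+1.
pose b k := 'C(n, k)%:R * dfalling lam y (n.+1 - k)%N * dfalling lam x k.
have -> : dfalling lam (x + y) n.+1 = \sum_(k < n.+1) a k + \sum_(k < n.+1) b k.
  rewrite dfallingS IHn mulr_suml -big_split; apply: eq_bigr => k _ /=.
  have lekn : (k <= n)%N by rewrite -ltnS.
  rewrite /a /b subSn // !dfallingS.
  have -> : lam *+ n = lam *+ (n - k) + lam *+ k by rewrite -mulrnDr subnK.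
  ring.
have -> : \sum_(k < n.+1) b k = \sum_(k < n.+2) b k.
  by rewrite [RHS]big_ord_recr /= [X in _ = _ + X]/b bin_small // !mul0r addr0.
rewrite [X in _ + X]big_ord_recl [RHS]big_ord_recl addrCA -big_split /=.
congr (_ + _); first by rewrite /b !bin0.
apply: eq_bigr => k _; rewrite /a /b /bump leq0n add1n subSS binS natrD; ring.
Qed.

End Factorials.

Section FubiniFunctional.
Variable R : realType.
Implicit Types (p q : {poly R}) (j k n : nat).

Local Notation shift p := (p \Po ('X + 1)).

(** The forward difference operator [p |-> p (X+1) - p (X)]. *)
Definition fdiff p : {poly R} := shift p - p.

Lemma fdiff_is_linear : linear fdiff.
Proof. by move=> a p q; rewrite /fdiff linearP /= scalerBr opprD addrACA. Qed.

HB.instance Definition _ :=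
  GRing.isLinear.Build R {poly R} {poly R} _ fdiff fdiff_is_linear.

Lemma iter_fdiff_is_linear j : linear (iter j fdiff).
Proof. by move=> a p q; elim: j => //= j ->; rewrite linearP. Qed.

HB.instance Definition _ j :=
  GRing.isLinear.Build R {poly R} {poly R} _ (iter j fdiff)
    (iter_fdiff_is_linear j).

Lemma falling_shift k :
  shift (falling ('X : {poly R}) k.+1) = falling 'X k * ('X + 1).
Proof.
rewrite /falling rmorph_prod big_ord_recl mulrC /=.
congr (_ * _); last by rewrite subr0 comp_polyX.
apply: eq_bigr => i _; rewrite rmorphB /= comp_polyX rmorph_nat.
by rewrite /bump leq0n add1n -natr1; ring.
Qed.

Lemma fdiff_falling k :
  fdiff (falling ('X : {poly R}) k) = k%:R *: falling 'X k.-1.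
Proof.
case: k => [|k]; first by rewrite scale0r /fdiff /falling !big_ord0 rmorph1 subrr.
rewrite /fdiff falling_shift /falling big_ord_recr /= -/(falling _ _).
by rewrite -mul_polyC polyC_natr; ring.
Qed.

Lemma iter_fdiff_falling j k :
  iter j fdiff (falling ('X : {poly R}) k) =
  (k ^_ j)%:R *: falling 'X (k - j).
Proof.
elim: j => [|j IHj]; first by rewrite ffactn0 scale1r subn0.
by rewrite iterS IHj linearZ /= fdiff_falling scalerA -natrM ffactnSr subnS.
Qed.

Lemma horner_falling0 k : (falling ('X : {poly R}) k).[0] = (k == 0)%:R.
Proof.
case: k => [|k]; first by rewrite /falling big_ord0 hornerC.
by rewrite /falling big_ord_recl /= subr0 hornerM hornerX mul0r.
Qed.

(** The functional [(X)_k |-> k!], in Newton's form: the sum of the differences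
    at 0 of orders 0 to [n].  The truncation at [n] is harmless on polynomials
    of degree at most [n]. *)
Definition fubini_form n p : R := \sum_(j < n.+1) (iter j fdiff p).[0].

Lemma fubini_form_is_linear n : scalar (fubini_form n).
Proof.
move=> a p q; rewrite /fubini_form mulr_sumr -big_split /=.
by apply: eq_bigr => j _; rewrite linearP /= hornerD hornerZ.
Qed.

HB.instance Definition _ n :=
  GRing.isLinear.Build R {poly R} R _ (fubini_form n) (fubini_form_is_linear n).

Lemma fubini_form_falling n k : (k <= n)%N ->
  fubini_form n (falling 'X k) = k`!%:R.
Proof.
rewrite -ltnS => ltkn; rewrite /fubini_form (bigD1 (Ordinal ltkn)) //=.
rewrite iter_fdiff_falling hornerZ subnn horner_falling0 mulr1 ffactnn.
rewrite big1 ?addr0 // => j; rewrite -val_eqE /= => neqjk.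
rewrite iter_fdiff_falling hornerZ horner_falling0.
have [ltkj|ltjk|eqjk] := ltngtP k j.
- by rewrite ffact_small // mul0r.
- by rewrite -(subnSK ltjk) mulr0.
- by rewrite eqjk eqxx in neqjk.
Qed.

(** The hypothesis says that [p] has degree at most [n]: it makes the
    truncated sum for [fdiff p] reach the last difference it needs. *)
Lemma fubini_form_shift n p : iter n.+1 fdiff p = 0 ->
  fubini_form n (shift p) = 2 * fubini_form n p - p.[0].
Proof.
move=> degp.
have diffE : fubini_form n (fdiff p) = fubini_form n p - p.[0].
  rewrite /fubini_form; under eq_bigr => j _ do rewrite -iterSr.
  rewrite big_ord_recr /= -iterS degp horner0 addr0.
  by rewrite big_ord_recl /= addrC addrA addNr add0r.
have -> : shift p = p + fdiff p by rewrite /fdiff addrCA subrr addr0.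
by rewrite linearD /= diffE; ring.
Qed.

End FubiniFunctional.

Section DegenerateFubini.
Variables (R : realType) (lam : R) (St : nat -> nat -> R).
Hypothesis hS : is_dstirling2 lam St.
Implicit Types (y : R) (n k : nat).

Local Notation dfallX y n := (dfalling lam%:P ('X + y%:P) n).

Lemma horner_dfalling y n : (dfallX y n).[0] = dfalling lam y n.
Proof.
rewrite /dfalling horner_prod; apply: eq_bigr => i _.
by rewrite -polyCMn !hornerE.
Qed.

Lemma dfalling_shift y n : dfallX y n \Po ('X + 1) = dfallX (1 + y) n.
Proof.
rewrite /dfalling rmorph_prod; apply: eq_bigr => i _.
rewrite -polyCMn /= comp_polyB comp_polyD comp_polyX !comp_polyC polyCD; ring.
Qed.

Lemma dfallingX_vandermonde y n :
  dfallX y n = \sum_(k < n.+1)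
    ('C(n, k)%:R * dfalling lam y (n - k)%N) *: dfalling lam%:P 'X k.
Proof.
have dfallC m : dfalling lam%:P y%:P m = (dfalling lam y m)%:P.
  rewrite /dfalling rmorph_prod; apply: eq_bigr => i _.
  by rewrite /= polyCB polyCMn.
rewrite dfallingD; apply: eq_bigr => k _.
by rewrite dfallC -mul_polyC polyCM polyC_natr.
Qed.

Lemma iter_fdiff_dfalling y n : iter n.+1 (@fdiff R) (dfallX y n) = 0.
Proof.
rewrite dfallingX_vandermonde linear_sum big1 // => k _.
rewrite linearZ /= -iterS hS linear_sum big1 ?scaler0 // => i _.
rewrite linearZ /= -iterS iter_fdiff_falling ffact_small ?scale0r ?scaler0 //.
exact: leq_trans (ltn_ord i) (ltn_ord k).
Qed.

Lemma fubini_form_dfalling y n :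
  fubini_form R n (dfallX y n) =
  \sum_(k < n.+1) 'C(n, k)%:R * dfalling lam y (n - k)%N * dfubini St k.
Proof.
rewrite dfallingX_vandermonde linear_sum; apply: eq_bigr => k _.
rewrite linearZ /= hS linear_sum /dfubini; congr (_ * _).
apply: eq_bigr => i _; rewrite linearZ /= fubini_form_falling //.
by rewrite -ltnS (leq_trans (ltn_ord i) (ltn_ord k)).
Qed.

(** In terms of the generating functions, with [e] the degenerate exponential
    and [F = 1 / (2 - e)], this is [e^(1+y) F = 2 e^y F - e^y]. *)
Lemma dfubini_shift y n :
  \sum_(k < n.+1) 'C(n, k)%:R * dfalling lam (1 + y) (n - k)%N * dfubini St k =
  2 * (\sum_(k < n.+1) 'C(n, k)%:R * dfalling lam y (n - k)%N * dfubini St k)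
  - dfalling lam y n.
Proof.
rewrite -!fubini_form_dfalling -dfalling_shift fubini_form_shift.
  by rewrite horner_dfalling.
exact: iter_fdiff_dfalling.
Qed.

End DegenerateFubini.

Theorem theorem2p11 (R : realType) (lam : R) (hlam : lam != 0)
    (St : nat -> nat -> R) (hS : is_dstirling2 lam St)
    (n : nat) (hn : (1 <= n)%N) :
  dfubini St n =
    2 * (\sum_(l < n.+1) 'C(n, l)%:R * dfubini St l
           * (-1) ^+ (n - l)%N * drising lam 1 (n - l)%N)
    + (-1) ^+ (n - 1)%N * drising lam 1 n
  /\
  \sum_(k < n.+1) 'C(n, k)%:R * dfalling lam (1 - lam) (n - k)%N * dfubini St k =
    2 * (\sum_(k < n.+1) 'C(n, k)%:R * (-1) ^+ (n - k)%N
           * drising lam lam (n - k)%N * dfubini St k)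
    + (-1) ^+ (n - 1)%N * drising lam lam n.
Proof.
have sign x : - dfalling lam (- x) n = (-1) ^+ (n - 1)%N * drising lam x n.
  by rewrite dfallingN -{1}(subnK hn) addn1 exprS; ring.
split; last first.
  rewrite (dfubini_shift _ _ _ hS) sign; congr (2 * _ + _).
  by apply: eq_bigr => k _; rewrite dfallingN mulrA.
have := dfubini_shift _ _ _ hS (-1) n; rewrite sign subrr.
(* As (0)_(m,lam) vanishes for m > 0, only the term k = n survives on the left. *)
rewrite big_ord_recr /= subnn dfalling0 binn !mul1r big1 => [|k _]; last first.
  by rewrite -(subnSK (ltn_ord k)) /dfalling big_ord_recl subr0 mul0r mulr0 mul0r.
rewrite add0r => ->; congr (2 * _ + _).
by apply: eq_bigr => k _; rewrite dfallingN; ring.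
Qed.
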